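(* Let $\varepsilon\in[0,1]$ and let $\mathcal{M}$ and $\mathcal{N}$ be finite LMCs. If $\mathcal{M}\simeq_\varepsilon\mathcal{N}$, then $\mathcal{M}\sim_\varepsilon^*\mathcal{N}$.
   Context: Fix a countable set $AP$ of atomic propositions. A labeled Markov chain (LMC) $\mathcal{M}=(S,P,s_{init},l)$ has a countable nonempty state set $S$, a transition function $P\colon S\to Distr(S)$ ($Distr(S)$ is the set of probability distributions on $S$), an initial state $s_{init}\in S$ and a labeling $l\colon S\to 2^{AP}$. It is finite if $S$ is finite. For $A\subseteq S$, $P(s)(A)=\sum_{t\in A}P(s)(t)$. The direct sum $\mathcal{M}\oplus\mathcal{N}$ is the LMC on the disjoint union of the state spaces with inherited transitions and labels (its initial state is irrelevant). An equivalence $R\subseteq S\times S$ is a (probabilistic) bisimulation on $\mathcal{M}$ if for all $(s,t)\in R$ and all $R$-equivalence classes $C$: $l(s)=l(t)$ and $P(s)(C)=P(t)(C)$. An $\varepsilon$-perturbation of $\mathcal{M}=(S,P,s_{init},l)$ is an LMC $\mathcal{M}'=(S,P',s_{init},l)$ with $\|P(s)-P'(s)\|_1=\sum_{t\in S}|P(s)(t)-P'(s)(t)|\le\varepsilon$ for all $s\in S$. An equivalence $R$ on $S$ is an $\varepsilon$-perturbed bisimulation on $\mathcal{M}$ if there is an $\varepsilon$-perturbation $\mathcal{M}'$ of $\mathcal{M}$ such that $R$ is a bisimulation on $\mathcal{M}'$. $s\simeq_\varepsilon t$ if $(s,t)\in R$ for some $\varepsilon$-perturbed bisimulation $R$; $\mathcal{M}\simeq_\varepsilon\mathcal{N}$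 if $s_{init}^{\mathcal{M}}\simeq_\varepsilon s_{init}^{\mathcal{N}}$ in $\mathcal{M}\oplus\mathcal{N}$. For $R\subseteq S\times S$ and $A\subseteq S$ let $R(A)=\{t\mid\exists s\in A\colon(s,t)\in R\}$. A reflexive and symmetric $R$ is an $\varepsilon$-bisimulation if for all $(s,t)\in R$ and all $A\subseteq S$: $l(s)=l(t)$ and $P(s)(A)\le P(t)(R(A))+\varepsilon$. $s\sim_\varepsilon^* t$ if $(s,t)\in R$ for some transitive $\varepsilon$-bisimulation $R$; $\mathcal{M}\sim_\varepsilon^*\mathcal{N}$ if $s_{init}^{\mathcal{M}}\sim_\varepsilon^* s_{init}^{\mathcal{N}}$ in $\mathcal{M}\oplus\mathcal{N}$. *)

(* Defs.v *)
From HB Require Import structures.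
From mathcomp Require Import all_boot all_order all_algebra.
From mathcomp Require Import classical_sets reals.

Set Implicit Arguments.
Unset Strict Implicit.
Unset Printing Implicit Defensive.

Import Order.TTheory GRing.Theory Num.Theory.
Local Open Scope ring_scope.

Record distr (R : realType) (S : finType) := Distr {
  dmass :> S -> R;
  dmass_ge0 : forall s, 0 <= dmass s;
  dmass_sum1 : \sum_s dmass s = 1
}.

Definition prob (R : realType) (S : finType) (p : distr R S) (A : {set S}) : R :=
  \sum_(t in A) p t.

Definition l1dist (R : realType) (S : finType) (p q : distr R S) : R :=
  \sum_t `|p t - q t|.

(* Finite labeled Markov chains on the state space S, which is nonempty because
   it contains the initial state. *)
Record lmc (R : realType) (AP : countType) (S : finType) := LMC {
  trans : S -> distr R S;
  init : S;
  label : S -> set AP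
}.

Section DirectSum.
Variables (R : realType) (AP : countType) (S T : finType).

Definition inl_mass (p : S -> R) (u : S + T) : R :=
  match u with inl s => p s | inr _ => 0 end.

Definition inr_mass (p : T -> R) (u : S + T) : R :=
  match u with inl _ => 0 | inr t => p t end.

Lemma inl_mass_ge0 (p : distr R S) u : 0 <= inl_mass p u.
Proof. by case: u => [s|t] //=; exact: dmass_ge0. Qed.

Lemma inl_mass_sum1 (p : distr R S) : \sum_u inl_mass p u = 1.
Proof. by rewrite big_sumType /= [X in _ + X]big1 // addr0 dmass_sum1. Qed.

Lemma inr_mass_ge0 (p : distr R T) u : 0 <= inr_mass p u.
Proof. by case: u => [s|t] //=; exact: dmass_ge0. Qed.

Lemma inr_mass_sum1 (p : distr R T) : \sum_u inr_mass p u = 1.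
Proof. by rewrite big_sumType /= [X in X + _]big1 // add0r dmass_sum1. Qed.

Definition inl_distr (p : distr R S) : distr R (S + T)%type :=
  Distr (inl_mass_ge0 p) (inl_mass_sum1 p).

Definition inr_distr (p : distr R T) : distr R (S + T)%type :=
  Distr (inr_mass_ge0 p) (inr_mass_sum1 p).

(* The choice of initial state is arbitrary: bisimilarity does not depend on it. *)
Definition dsum (M : lmc R AP S) (N : lmc R AP T) : lmc R AP (S + T)%type :=
  {| trans := fun u => match u with
                       | inl s => inl_distr (trans M s)
                       | inr t => inr_distr (trans N t)
                       end;
     init := inl (init M);
     label := fun u => match u with
                       | inl s => label M s
                       | inr t => label N t
                       end |}.

End DirectSum.

Section Bisimulation.
Variables (R : realType) (AP : countType) (S : finType).
Implicit Types (M : lmc R AP S) (r : rel S) (eps : R).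

Definition is_equivalence r := [/\ reflexive r, symmetric r & transitive r].

Definition bisimulation M r :=
  is_equivalence r /\
  forall s t, r s t ->
    label M s = label M t /\
    forall C, C \in equivalence_partition r [set: S] ->
      prob (trans M s) C = prob (trans M t) C.

Definition perturbation eps M M' :=
  [/\ init M' = init M,
      label M' = label M &
      forall s, l1dist (trans M s) (trans M' s) <= eps].

Definition perturbed_bisimulation eps M r :=
  is_equivalence r /\
  exists M', perturbation eps M M' /\ bisimulation M' r.

Definition perturbed_bisimilar eps M s t :=
  exists r, perturbed_bisimulation eps M r /\ r s t.

Definition relimage r (A : {set S}) : {set S} := [set t | [exists s in A, r s t]].

Definition eps_bisimulation eps M r :=
  [/\ reflexive r, symmetric r &
      forall s t, r s t -> forall A : {set S},
        label M s = label M t /\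
        prob (trans M s) A <= prob (trans M t) (relimage r A) + eps].

Definition trans_eps_bisimilar eps M s t :=
  exists r, [/\ eps_bisimulation eps M r, transitive r & r s t].

End Bisimulation.

Definition lmc_perturbed_bisimilar (R : realType) (AP : countType)
    (S T : finType) (eps : R) (M : lmc R AP S) (N : lmc R AP T) :=
  perturbed_bisimilar eps (dsum M N) (inl (init M)) (inr (init N)).

Definition lmc_trans_eps_bisimilar (R : realType) (AP : countType)
    (S T : finType) (eps : R) (M : lmc R AP S) (N : lmc R AP T) :=
  trans_eps_bisimilar eps (dsum M N) (inl (init M)) (inr (init N)).

(* Main.v *)
(* The perturbed bisimulation r is itself a transitive eps-bisimulation.  Passing
   from P(s) to P'(s), and from P'(t) back to P(t), changes the mass of any set by
   at most eps / 2, because the two distributions have equal total mass; and P'(s),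
   P'(t) agree on the r-closed set r(A), which is a union of classes. *)
Require Import Defs.
From mathcomp Require Import all_boot all_order all_algebra.
From mathcomp Require Import reals lra.

Set Implicit Arguments.
Unset Strict Implicit.
Unset Printing Implicit Defensive.

Import Order.TTheory GRing.Theory Num.Theory.
Local Open Scope ring_scope.

Lemma prob_le (R : realType) (S : finType) (p : distr R S) (A B : {set S}) :
  A \subset B -> prob p A <= prob p B.
Proof.
move=> sAB; rewrite /prob [leRHS](big_setID A) /= (setIidPr sAB).
by rewrite lerDl sumr_ge0 // => x _; exact: dmass_ge0.
Qed.

Lemma prob_setC (R : realType) (S : finType) (p : distr R S) (A : {set S}) :
  prob p A + prob p (~: A) = 1.
Proof.
rewrite -(dmass_sum1 p) (bigID (mem A)) /=; congr (_ + _).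
by apply: eq_bigl => x; rewrite inE.
Qed.

Lemma l1distC (R : realType) (S : finType) (p q : distr R S) :
  l1dist p q = l1dist q p.
Proof. by apply: eq_bigr => x _; rewrite distrC. Qed.

(** Both masses total 1, so the excess of [p] over [q] on [A] equals the excess of [q] over [p] on
    [~: A]. Disjoint parts of the sum in [l1dist] bound these two excesses, hence the factor 2. *)
Lemma prob_sub_le_l1dist (R : realType) (S : finType) (p q : distr R S)
    (A : {set S}) : (prob p A - prob q A) *+ 2 <= l1dist p q.
Proof.
have pA := prob_setC p A; have qA := prob_setC q A.
have -> : (prob p A - prob q A) *+ 2 =
          (prob p A - prob q A) + (prob q (~: A) - prob p (~: A)) by lra.
rewrite /l1dist (bigID (mem A)) /=; apply: lerD; rewrite /prob -sumrB.
  by apply: ler_sum => x _; exact: ler_norm.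
under [leRHS]eq_bigl => x do rewrite -in_setC.
by apply: ler_sum => x _; rewrite distrC ler_norm.
Qed.

(** The set [B] is the disjoint union of the classes of its elements, so additivity reduces the
    equality to single classes. *)
Lemma prob_closed_eq (R : realType) (S : finType) (r : rel S)
    (p q : distr R S) (B : {set S}) :
  is_equivalence r -> (forall x y, r x y -> x \in B -> y \in B) ->
  (forall C, C \in equivalence_partition r [set: S] -> prob p C = prob q C) ->
  prob p B = prob q B.
Proof.
move=> [rr rs rt] closedB eqpq.
have partB : partition (equivalence_partition r B) B.
  apply: equivalence_partitionP => x y z _ _ _; split=> // rxy.
  by apply/idP/idP; apply: rt; rewrite // rs.
rewrite /prob !(set_partition_big _ partB) /=; apply: eq_bigr => C /imsetP[x xB ->].
(* The class of [x] cut down to [B] is its full class in [S], since closedness puts every [y] with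
   [r x y] into [B]. *)
apply: eqpq; apply/imsetP; exists x; rewrite ?inE //.
by apply/setP => y; rewrite !inE; case: (boolP (r x y)) => [/closedB->|]; rewrite ?andbF.
Qed.

Lemma relimage_closed (S : finType) (r : rel S) (A : {set S}) x y :
  transitive r -> r x y -> x \in relimage r A -> y \in relimage r A.
Proof.
move=> rt rxy; rewrite !inE => /exists_inP[z zA rzx].
by apply/exists_inP; exists z => //; exact: rt rxy.
Qed.

Lemma sub_relimage (S : finType) (r : rel S) (A : {set S}) :
  reflexive r -> A \subset relimage r A.
Proof. by move=> rr; apply/subsetP => x xA; rewrite inE; apply/exists_inP; exists x. Qed.

Lemma perturbed_bisimulation_eps (R : realType) (AP : countType) (S : finType)
    (M : lmc R AP S) (eps : R) (r : rel S) :
  perturbed_bisimulation eps M r -> eps_bisimulation eps M r.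
Proof.
move=> [req [M' [[_ eql close] [_ bis]]]].
have [rr rs rt] := req; split=> // s t rst A.
have [lst pst] := bis s t rst; split; first by rewrite -eql.
set B := relimage r A.
have AB := prob_le (trans M s) (sub_relimage A rr).
have eqB : prob (trans M' s) B = prob (trans M' t) B.
  by apply: (prob_closed_eq req) => // x y; exact: relimage_closed.
have sB := le_trans (prob_sub_le_l1dist (trans M s) (trans M' s) B) (close s).
have := prob_sub_le_l1dist (trans M' t) (trans M t) B.
rewrite l1distC => /le_trans /(_ (close t)) tB.
(* With P and P' the transitions of [M] and [M'], the chain is P(s)(A) <= P(s)(B) <= P'(s)(B) +
   eps/2 = P'(t)(B) + eps/2 <= P(t)(B) + eps. *)
rewrite -/B in AB; lra.
Qed.

Theorem lemma4p5 (R : realType) (AP : countType) (S T : finType)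
    (M : lmc R AP S) (N : lmc R AP T) (eps : R) (heps : 0 <= eps <= 1) :
  lmc_perturbed_bisimilar eps M N -> lmc_trans_eps_bisimilar eps M N.
Proof.
move=> [r [pert rMN]]; exists r; split=> //.
  exact: perturbed_bisimulation_eps.
by case: pert => [[]].
Qed.
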